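(* Let $1\le \ell<k$ be integers and let $F$ be a $k$-graph with $\pi_\ell(F)=0$. Then (a) $F$ has an $(\ell+1)$-vanishing order, and (b) for every $S\in V(F)^{(\ell-1)}$, the link $L_F(S)$ is a $(k-\ell+1)$-partite $(k-\ell+1)$-graph.
   Context: A $k$-graph is a finite $k$-uniform hypergraph, with vertex set $V(F)$ and edge set $E(F)$. For a set $V$, $V^{(t)}$ denotes the collection of all $t$-subsets of $V$, and $[n]=\{1,\dots,n\}$. An $r$-graph is $r$-partite if its vertex set can be partitioned into $r$ parts such that every edge has exactly one vertex in each part. Degrees and degree Turán density. For a $k$-graph $H$ and $S\subseteq V(H)$ with $|S|<k$, the link $L_H(S)$ is the $(k-|S|)$-graph on $V(H)\setminus S$ with edge set $\{e\setminus S: S\subset e\in E(H)\}$ (so $L_H(\varnothing)=H$); the degree of $S$ is $d_H(S)=|E(L_H(S))|$; the minimum $\ell$-degree $\delta_\ell(H)$ is the minimum of $d_H(S)$ over all $\ell$-subsets $S$ of $V(H)$. $H$ is $F$-free if it contains no copy of $F$ as a (not necessarily induced) subhypergraph. For $1\le \ell<k$ and a $k$-graph $F$, $\mathrm{ex}_\ell(n,F)$ is the maximum of $\delta_\ell(H)$ over all $n$-vertex $F$-free $k$-graphs $H$, and $\pi_\ell(F)=\lim_{n\to\infty}\mathrm{ex}_\ell(n,F)/\binom{n-\ell}{k-\ell}$ (this limit is known to exist). Vanishing orders. An ordering of a finite set $S$ is a bijection $\sigma:S\to[|S|]$. Given integers $1\le j\le k$ and a $k$-graph $F$, an ordering $\sigma$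 of $V(F)$ is a $j$-vanishing order of $F$ if there is a coloring $\varphi:V(F)^{(j)}\to [k]^{(j)}$ such that for every edge $e=\{v_1,\dots,v_k\}\in E(F)$ with $\sigma(v_1)<\cdots<\sigma(v_k)$ and every $\mathcal L\in[k]^{(j)}$ one has $\varphi(\{v_i:i\in\mathcal L\})=\mathcal L$. *)

(* Defs.v *)
From mathcomp Require Import all_boot all_order all_algebra.
From mathcomp Require Import classical_sets reals topology normedtype sequences.

Set Implicit Arguments.
Unset Strict Implicit.
Unset Printing Implicit Defensive.

Import Order.TTheory GRing.Theory Num.Theory.
Import numFieldNormedType.Exports.

(* A hypergraph is given by its edge set; its vertex set is the whole finite
   type V. *)
Definition hypergraph (V : finType) := {set {set V}}.

Definition is_kgraph (k : nat) (V : finType) (H : hypergraph V) : bool :=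
  [forall e in H, #|e| == k].

(* Parts may be empty, as usual for r-partite hypergraphs; this only matters
   when H has no edge. *)
Definition is_partite (r : nat) (V : finType) (H : hypergraph V) : Prop :=
  exists P : 'I_r -> {set V},
    [/\ forall i j, i != j -> [disjoint P i & P j],
        \bigcup_(i < r) P i = [set: V]
      & forall e : {set V}, e \in H -> forall i, #|e :&: P i| = 1].

(* The vertex set of the link of S is the type of the vertices outside S; the
   set e :\: S, seen in this type, is the preimage of e by val. *)
Definition link (V : finType) (H : hypergraph V) (S : {set V}) :
    hypergraph {x : V | x \notin S} :=
  [set val @^-1: e | e : {set V} in H & S \subset e].

Definition degree (V : finType) (H : hypergraph V) (S : {set V}) : nat :=
  #|link H S|.

Lemma degree_le_edges (V : finType) (H : hypergraph V) (S : {set V}) :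
  degree H S <= #|H|.
Proof.
apply: leq_trans (leq_imset_card _ _) _.
by apply/subset_leq_card/fintype.subsetP => e; rewrite inE => /andP[].
Qed.

(* By degree_le_edges, the default value #|H| does not change the minimum as
   soon as there is a set of l vertices. *)
Definition min_degree (l : nat) (V : finType) (H : hypergraph V) : nat :=
  \big[minn/#|H|]_(S : {set V} | #|S| == l) degree H S.

Definition contains_copy (V W : finType) (F : hypergraph V) (H : hypergraph W)
    : bool :=
  [exists f : {ffun V -> W},
     injectiveb f && [forall e in F, f @: (e : {set V}) \in H]].

(* The maximum over the empty family, which only arises for an edgeless F, is
   0. *)
Definition ex_degree (k l n : nat) (V : finType) (F : hypergraph V) : nat :=
  \max_(H : {set {set 'I_n}} | is_kgraph k H && ~~ contains_copy F H)
     min_degree l H.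

(* "pi_l(F) = p": the value p is a limit in the sense of convergence, so that
   no default value of [lim] is involved. *)
Definition degree_turan_density (R : realType) (k l : nat) (V : finType)
    (F : hypergraph V) (p : R) : Prop :=
  ((fun n : nat => (ex_degree k l n F)%:R / 'C(n - l, k - l)%:R : R)%R
     @ \oo --> p)%classic.

(* [k] is 'I_k, so that positions start at 0. The colouring phi is only
   relevant on j-sets; v enumerates e increasingly with respect to sigma. *)
Definition is_vanishing_order (j k : nat) (V : finType) (F : hypergraph V)
    (sigma : V -> 'I_#|V|) : Prop :=
  bijective sigma /\
  exists phi : {set V} -> {set 'I_k},
    (forall A : {set V}, #|A| = j -> #|phi A| = j) /\
    (forall e : {set V}, e \in F -> forall v : 'I_k -> V,
       [set v i | i : 'I_k] = e ->
       (forall i1 i2 : 'I_k, i1 < i2 -> sigma (v i1) < sigma (v i2)) ->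
       forall L : {set 'I_k}, #|L| = j -> phi [set v i | i in L] = L).

Definition has_vanishing_order (j k : nat) (V : finType) (F : hypergraph V) :
    Prop :=
  exists sigma : V -> 'I_#|V|, is_vanishing_order j k F sigma.

(* Main.v *)
Require Import Defs.
From mathcomp Require Import boolp classical_sets reals topology normedtype sequences.
From mathcomp Require Import all_boot all_order all_algebra.
From mathcomp Require Import ring lra zify.

(** Both parts have contrapositives of the same kind: if F lacks the structure
    in question, there are arbitrarily large F-free k-graphs whose minimum
    l-degree is a positive proportion of the trivial maximum. These k-graphs
    are read off from a random colouring phi, with a fixed finite set of
    colours, of the pairs (A, z) of a vertex set A and a vertex z.

    For (a), the vertices are linearly ordered and the colours are sets of
    positions. The edges are the k-sets v_0 < ... < v_(k-1) for which
    phi (v(L \ i), v_i) = L for every set L of l + 1 positions and i in L. A copy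
    of F in this k-graph pulls the order and the colouring back to an
    (l + 1)-vanishing order of F. For (b), there are k - l + 1 colours, and the
    edges are the k-sets e such that phi (A, .) is injective on e \ A for every
    (l - 1)-set A in e. In this k-graph phi (A, .) shows that the link of A is
    (k - l + 1)-partite, and this property passes to subhypergraphs.

    The point is that every l-set S lies in many edges. Vertices are added to S
    one at a time. When x is added to T, all requirements concern pairs (A, z)
    whose vertices lie in T and x and include x, so those for different x are
    independent and each vertex x succeeds with probability bounded below.
    A bound on an exponential moment (sum_agrees_prod) and a union bound over
    all boundedly many-vertex configurations (random_colouring) give one
    colouring for which every step has linearly many admissible x
    (rich_colouring). Hence S lies in a constant proportion of the maximal
    number of edges (card_extensions), which contradicts density 0 unless F is
    contained (zero_density_contains_copy). It remains to check in each case
    that the requirements of one step can be prescribed without knowing x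
    (position_extend, rainbow_links_extend).

    In (a) the prescription must know the positions that the vertices will have
    in the final edge. To this end the ordered vertex set is cut into k
    consecutive blocks. At least k - l blocks avoid S, and the new vertices are
    taken one from each of k - l such blocks, so that all final positions are
    known from the start. *)

Set Implicit Arguments.
Unset Strict Implicit.
Unset Printing Implicit Defensive.
Import Order.TTheory GRing.Theory Num.Theory.
Import numFieldNormedType.Exports.

(** * Random colourings meeting many independent requirements *)

Section RandomColouring.
Local Open Scope ring_scope.
Variables I C : finType.
Implicit Types (U V : {set I}) (tau : I -> C) (phi : {ffun I -> C}).

Definition agrees V tau phi : bool := [forall i in V, phi i == tau i].

Lemma agreesU V U tau phi :
  agrees (V :|: U) tau phi = agrees V tau phi && agrees U tau phi.
Proof.
apply/forall_inP/andP=> [h|[/forall_inP hV /forall_inP hU] i].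
  by split; apply/forall_inP=> i ?; apply: h; rewrite inE; apply/orP; auto.
by rewrite inE => /orP[/hV|/hU].
Qed.

Let q : rat := #|C|%:R^-1.
Let total : rat := #|{ffun I -> C}|%:R.

Lemma sum_agrees (c0 : C) V tau :
  \sum_(phi : {ffun I -> C}) (agrees V tau phi)%:R = total * q ^+ #|V|.
Proof.
have C0 : #|C|%:R != 0 :> rat by rewrite pnatr_eq0 -lt0n; apply/card_gt0P; exists c0.
transitivity (\sum_(phi : {ffun I -> C}) \prod_i (if i \in V then (phi i == tau i)%:R else 1 : rat)).
  apply: eq_bigr => phi _; rewrite /agrees; case: forall_inP => [h|h].
    by rewrite big1 // => i _; case: ifP => // /h ->.
  case: (boolP [exists i in V, phi i != tau i]) => [/exists_inP[i iV /negbTE ne]|].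
    by rewrite (bigD1 i) //= iV ne mul0r.
  by rewrite negb_exists_in => /forall_inP h'; case: h => i /h'; rewrite negbK.
rewrite -(bigA_distr_bigA (fun i c => if i \in V then (c == tau i)%:R else 1 : rat)).
rewrite (bigID (mem V)) /= big1 => [|i iV]; last first.
  by rewrite iV (bigD1 (tau i)) //= eqxx big1 ?addr0 // => c /negbTE ->.
rewrite mul1r (eq_bigr (fun=> #|C|%:R)) => [|i /negbTE ->]; last first.
  by rewrite sumr_const.
rewrite prodr_const /total card_ffun natrX /q exprVn.
have -> : #|[pred i | i \notin V]| = #|~: V| by apply: eq_card => i; rewrite !inE.
by rewrite -[in RHS](cardsC V) exprD mulrAC divff ?expf_neq0 // mul1r.
Qed.

(** The factor of x is 1/2 if the requirement at x is met and 1 otherwise, so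
    for empty V the left side is the sum of 2^-(number of requirements met).
    Expanding one factor turns it into a difference of two sums of the same
    form, the second with U x added to V; this is why V appears. *)
Lemma sum_agrees_prod (X : eqType) (c0 : C) (U : X -> {set I}) tau (xs : seq X) V :
  (forall x y, x != y -> [disjoint U x & U y]) -> uniq xs ->
  (forall x, x \in xs -> [disjoint V & U x]) ->
  \sum_(phi : {ffun I -> C}) (agrees V tau phi)%:R * \prod_(x <- xs) (1 - (agrees (U x) tau phi)%:R / 2) =
  total * q ^+ #|V| * \prod_(x <- xs) (1 - q ^+ #|U x| / 2).
Proof.
move=> disU; elim: xs V => [|x xs IH] V /=.
  by move=> _ _; rewrite big_nil mulr1 -(sum_agrees c0 V tau); apply: eq_bigr => phi _;
    rewrite big_nil mulr1.
move=> /andP[xxs uxs] disV.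
under eq_bigr => phi _.
  rewrite big_cons mulrA mulrBr mulr1 mulrBl mulrA -natrM mulnb -agreesU mulrAC.
  over.
rewrite /= sumrB -mulr_suml !IH // => [|y yxs|y yxs].
- rewrite big_cons cardsU (disjoint_setI0 (disV x _)) ?mem_head// cards0 subn0 exprD; ring.
- rewrite disjoints_subset subUset -!disjoints_subset disV ?inE ?yxs ?orbT // disU //.
  by apply: contraNneq xxs => ->.
- by apply: disV; rewrite inE yxs orbT.
Qed.

Lemma prod_half (X : finType) (A : {set X}) (Z : pred X) :
  \prod_(x in A) (1 - (Z x)%:R / 2 : rat) = 2^-1 ^+ #|[set x in A | Z x]|.
Proof.
rewrite (bigID Z) /= [X in _ * X]big1 ?mulr1 => [|x /andP[_ /negbTE ->]]; last by rewrite mul0r subr0.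
rewrite (eq_bigr (fun=> 2^-1)) => [|x /andP[_ ->]]; last by rewrite (_ : true%:R = 1) //; lra.
by rewrite prodr_const; congr (_ ^+ _); apply: eq_card => x; rewrite !inE.
Qed.

(** Bernoulli's inequality for 1 + y, combined with (1 - y)(1 + y) <= 1. *)
Lemma bernoulli_inv (y : rat) n : 0 <= y <= 1 -> (1 - y) ^+ n * (1 + n%:R * y) <= 1.
Proof.
move=> /andP[y0 y1]; elim: n => [|n IH]; first by rewrite expr0; lra.
apply: le_trans IH; rewrite exprSr -mulrA ler_wpM2l ?exprn_ge0 ?subr_ge0 //.
have : 0 <= n%:R :> rat by []. rewrite -natr1; nra.
Qed.

(** Meeting a requirement of size at most a has probability at least
    1 / #|C|^a, so the exponential moment of the number of requirements of p
    that are met is at most (1 - 1/(2 #|C|^a))^(6 #|C|^a L) <= 4^-L. By Markov's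
    inequality, fewer than L are met with probability at most 2^L 4^-L = 2^-L,
    which leaves room for a union bound over fewer than 2^L values of p. *)
Lemma random_colouring (c0 : C) (P X : finType) (a L : nat) (A : P -> {set X})
    (U : P -> X -> {set I}) (tau : P -> I -> C) :
  (forall p x y, x != y -> [disjoint U p x & U p y]) ->
  (forall p x, #|U p x| <= a)%N ->
  (forall p, 6 * #|C| ^ a * L <= #|A p|)%N ->
  (#|P| < 2 ^ L)%N ->
  exists phi, forall p, (L <= #|[set x in A p | agrees (U p x) (tau p) phi]|)%N.
Proof.
move=> disU cardU cardA cardP.
pose bad p phi := (#|[set x in A p | agrees (U p x) (tau p) phi]| < L)%N.
suff [phi h] : exists phi, [forall p, ~~ bad p phi].
  by exists phi => p; rewrite leqNgt; exact: (forallP h).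
apply/existsP; apply: contraTT isT; rewrite negb_exists => /forallP allbad.
have C0 : (0 < #|C|)%N by apply/card_gt0P; exists c0.
have total0 : 0 < total by rewrite ltr0n card_ffun expn_gt0 C0.
have q0 : 0 < q by rewrite invr_gt0 ltr0n.
have q1 : q <= 1 by rewrite invf_le1 ?ltr0n // ler1n.
have rare p : \sum_(phi : {ffun I -> C}) (bad p phi)%:R <= total * 2^-1 ^+ L.
  have step1 : (\sum_(phi : {ffun I -> C}) (bad p phi)%:R) * 2^-1 ^+ L <=
      \sum_(phi : {ffun I -> C}) \prod_(x in A p) (1 - (agrees (U p x) (tau p) phi)%:R / 2 : rat).
    rewrite mulr_suml; apply: ler_sum => phi _; rewrite prod_half.
    rewrite /bad; case: ltnP => [lt|_]; last by rewrite mul0r exprn_ge0.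
    by rewrite mul1r; apply: ler_wiXn2l => //; apply: ltnW.
  have step2 : \sum_(phi : {ffun I -> C}) \prod_(x in A p) (1 - (agrees (U p x) (tau p) phi)%:R / 2 : rat)
      = total * \prod_(x in A p) (1 - q ^+ #|U p x| / 2).
    have := @sum_agrees_prod _ c0 (U p) (tau p) (enum (A p)) set0 (disU p) (enum_uniq _).
    rewrite cards0 mulr1 !big_enum /= => <- => [|x _]; last by rewrite disjoints_subset sub0set.
    apply: eq_bigr => phi _; rewrite big_enum /= (_ : agrees _ _ _ = true) ?mul1r //.
    by apply/forall_inP => i; rewrite inE.
  pose y : rat := q ^+ a / 2.
  have y01 : 0 <= y <= 1.
    have : q ^+ a <= 1 by rewrite exprn_ile1 // ltW.
    have : 0 <= q ^+ a by rewrite exprn_ge0 // ltW.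
    rewrite /y; move=> *; apply/andP; lra.
  have step3 : \prod_(x in A p) (1 - q ^+ #|U p x| / 2) <= (1 - y) ^+ #|A p|.
    rewrite -prodr_const; apply: ler_prod => x _.
    have h1 : q ^+ #|U p x| <= 1 by rewrite exprn_ile1 // ltW.
    have h2 : q ^+ a <= q ^+ #|U p x| by apply: ler_wiXn2l => //; exact: ltW.
    rewrite /y; apply/andP; lra.
  have step4 : (1 - y) ^+ #|A p| <= (2^-1 * 2^-1) ^+ L.
    apply: (@le_trans _ _ ((1 - y) ^+ (6 * #|C| ^ a * L))).
      by apply: ler_wiXn2l => //; lra.
    rewrite exprM; apply: lerXn2r; rewrite ?nnegrE ?mulr_ge0 ?exprn_ge0 //; first by lra.
    have := bernoulli_inv (6 * #|C| ^ a) y01.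
    have -> : (6 * #|C| ^ a)%:R * y = 3.
      rewrite /y /q natrM natrX exprVn.
      have : #|C|%:R ^+ a != 0 :> rat by rewrite expf_neq0 // pnatr_eq0 -lt0n.
      by move: (_ ^+ a) => z z0; field.
    lra.
  have p0 : 0 < (2^-1 : rat) ^+ L by rewrite exprn_gt0.
  rewrite -(ler_pM2r p0); apply: le_trans step1 _; rewrite step2 -mulrA -exprMn.
  by rewrite ler_wpM2l ?(ltW total0) // (le_trans step3).
suff : total <= total * (#|P|%:R * 2^-1 ^+ L).
  rewrite -[leLHS]mulr1 ler_pM2l // exprVn ler_pdivlMr ?exprn_gt0 // mul1r -natrX.
  by rewrite ler_nat leqNgt cardP.
rewrite mulrCA; apply: (@le_trans _ _ (\sum_p \sum_(phi : {ffun I -> C}) (bad p phi)%:R)).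
  rewrite exchange_big /= /total -sumr_const (eq_bigl xpredT) //; apply: ler_sum => phi _.
  have := allbad phi; rewrite negb_forall => /existsP[p]; rewrite negbK => bp.
  by rewrite (bigD1 p) //= bp lerDl sumr_ge0.
apply: le_trans (ler_sum _ (fun p _ => rare p)) _.
by rewrite sumr_const [leRHS]mulr_natl lexx.
Qed.

End RandomColouring.

(** * Colourings with the extension property *)

(** For L = k M one has 2^L = (2^M)^k, so it is enough that 2^M exceeds a linear
    function of M. *)
Lemma exists_exp_gt_poly k K c L0 : 0 < k ->
  exists2 L, L0 <= L & k * (k * (K * L + k)) ^ k * c < 2 ^ L.
Proof.
move=> k0; pose B := k * c * (k * (K * k + k)).
pose i := (2 * B + L0).+1.
exists (k * (2 * i)); first by rewrite /i; nia.
have lt : k * c * (k * (K * (k * (2 * i)) + k)) < 2 ^ (2 * i).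
  apply: (@leq_ltn_trans (B * (2 * i))).
    have : k <= k * (2 * i) by rewrite leq_pmulr // muln_gt0.
    rewrite /B; move: (2 * i) => M h.
    rewrite -[leqRHS]mulnA leq_mul2l -mulnA leq_mul2l; nia.
  rewrite mul2n -addnn expnD.
  have := ltn_expl i (isT : 1 < 2).
  by rewrite /i; nia.
move: (k * (K * (k * (2 * i)) + k)) lt => Z lt.
apply: (@leq_ltn_trans ((k * c * Z) ^ k)); last by rewrite (mulnC k (2 * i)) expnM ltn_exp2r.
rewrite mulnAC expnMn leq_mul2r; apply/orP; right.
case: (posnP (k * c)) => [->//|kc0].
by rewrite -[leqLHS]expn1 leq_pexp2l.
Qed.

Section Extension.
Variables (n : nat) (C : finType).
Implicit Types (T A : {set 'I_n}) (x y z : 'I_n).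

(** Colouring pairs (A, z) rather than sets z |: A lets the colour depend on
    which vertex of the set is singled out. *)
Definition pointed_colouring := {ffun {set 'I_n} * 'I_n -> C}.

(** The value psi A None is prescribed for the pair (A, x) and psi A (Some y)
    for (x |: A, y): the prescription does not depend on x. *)
Definition realizes (phi : pointed_colouring) T (psi : {set 'I_n} -> option 'I_n -> C) x :=
  [forall A : {set 'I_n}, (A \subset T) ==>
    (phi (A, x) == psi A None) &&
    [forall y in T, phi (x |: A, y) == psi A (Some y)]].

End Extension.

Lemma block_proof k N (x : 'I_(k * N)) : x %/ N < k.
Proof. by case: N x => [[x]|N x]; rewrite ?muln0 // ltn_divLR. Qed.

Definition block k N (x : 'I_(k * N)) : 'I_k := Ordinal (block_proof x).

Lemma card_block k N (b : 'I_k) : N <= #|[set x : 'I_(k * N) | block x == b]|.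
Proof.
have lt (i : 'I_N) : b * N + i < k * N.
  apply: (@leq_trans (b.+1 * N)); last by rewrite leq_mul2r ltn_ord orbT.
  by rewrite mulSn addnC ltn_add2r.
rewrite -[leqLHS]card_ord -cardsT.
have inj : injective (fun i => Ordinal (lt i)).
  by move=> i j /(congr1 val) /= /addnI /val_inj.
rewrite -(card_imset _ inj) subset_leq_card //; apply/subsetP => _ /imsetP[i _ ->].
by rewrite inE -val_eqE /= divnMDl ?(leq_trans _ (ltn_ord i)) // divn_small ?addn0.
Qed.

(** As L is a fixed proportion of k * N up to an additive constant, each step of an
    extension process over sets of at most k vertices has linearly many choices
    inside any given block. *)
Lemma rich_colouring k (C : finType) (c0 : C) : 0 < k ->
  exists2 K, 0 < K & forall L0, exists2 L, L0 <= L &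
  let N := K * L + k in
  exists phi : pointed_colouring (k * N) C,
  forall (T : {set 'I_(k * N)}) (b : 'I_k) psi, 0 < #|T| <= k ->
  L <= #|[set x : 'I_(k * N) | (block x == b) && (x \notin T) && realizes phi T psi x]|.
Proof.
move=> k0.
pose a := #|{: {set 'I_k} * bool * option 'I_k}|.
pose c := #|{ffun {set 'I_k} * option 'I_k -> C}|.
exists (6 * #|C| ^ a) => [|L0].
  by rewrite muln_gt0 expn_gt0; apply/orP; left; apply/card_gt0P; exists c0.
have [L leL ltL] := exists_exp_gt_poly (6 * #|C| ^ a) c L0 k0.
exists L => // N; set n := k * N.
(* A configuration (b, T, psi) is encoded with T as the image of a map t from
   'I_k and psi pulled back along t; this leaves only polynomially many. *)
pose P : finType := ('I_k * {ffun 'I_k -> 'I_n} * {ffun {set 'I_k} * option 'I_k -> C})%type.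
pose Im (t : {ffun 'I_k -> 'I_n}) := t @: [set: 'I_k].
pose X (p : P) := [set x : 'I_n | (block x == p.1.1) && (x \notin Im p.1.2)].
(* U p x contains the pairs that lie in T and x and involve x. These sets are
   disjoint for different x, and of size bounded in terms of k. *)
pose U (p : P) (x : 'I_n) :=
  [set i : {set 'I_n} * 'I_n | (i.2 |: i.1) :\: Im p.1.2 == [set x]].
pose tau (p : P) (i : {set 'I_n} * 'I_n) :=
  p.2 (p.1.2 @^-1: i.1, [pick j | p.1.2 j == i.2]).
have [|p x|p||phi hphi] := @random_colouring _ C c0 P 'I_n a L X U tau.
- move=> p x y; apply: contraR => /pred0Pn[i /andP[]].
  by rewrite !inE => /eqP-> /eqP/set1_inj->.
- pose f (h : {set 'I_k} * bool * option 'I_k) : {set 'I_n} * 'I_n :=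
    ((if h.1.2 then x |: p.1.2 @: h.1.1 else p.1.2 @: h.1.1), oapp p.1.2 x h.2).
  apply: leq_trans (leq_imset_card f predT); apply: subset_leq_card.
  apply/subsetP => -[B z]; rewrite inE /= => /eqP E.
  have inT y : y \in z |: B -> y = x \/ exists j, y = p.1.2 j.
    move=> yB; case: (boolP (y \in Im p.1.2)) => [/imsetP[j _ ->]|yT]; first by right; exists j.
    by left; apply/set1P; rewrite -E inE yT.
  have xT : x \notin Im p.1.2 by have := set11 x; rewrite -E inE => /andP[].
  have [o oE] : exists o, oapp p.1.2 x o = z.
    by case: (inT z (setU11 _ _)) => [->|[j ->]]; [exists None|exists (Some j)].
  apply/imsetP; exists (p.1.2 @^-1: B, x \in B, o) => //; rewrite /f /= oE; congr (_, _).
  apply/setP => y; apply/idP/idP => [yB|].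
    case: (inT y); first by rewrite !inE yB orbT.
      by move=> yx; move: (yB); rewrite yx => ->; rewrite setU11.
    move=> [j yj]; have : y \in p.1.2 @: (p.1.2 @^-1: B).
      by rewrite yj imset_f // inE -yj.
    by case: ifP => // _ h; rewrite inE h orbT.
  case: ifP => [xB|_]; first by rewrite inE => /orP[/set1P->//|/imsetP[j]]; rewrite inE => ? ->.
  by move=> /imsetP[j]; rewrite inE => ? ->.
- have -> : X p = [set x : 'I_n | block x == p.1.1] :\: Im p.1.2.
    by apply/setP => x; rewrite !inE andbC.
  rewrite cardsD leq_subRL; last by rewrite subset_leq_card // subsetIl.
  apply: leq_trans (card_block N p.1.1); rewrite addnC leq_add2l.
  apply: leq_trans (subset_leq_card (subsetIr _ _)) _.
  by apply: leq_trans (leq_imset_card _ _) _; rewrite cardsT card_ord.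
- by rewrite !card_prod card_ord card_ffun !card_ord.
exists phi => T b psi /andP[T0 Tk].
have [x0 x0T] := card_gt0P T0.
pose t : {ffun 'I_k -> 'I_n} := [ffun i : 'I_k => nth x0 (enum T) i].
have ImT : Im t = T.
  apply/setP => y; apply/imsetP/idP => [[j _ ->]|yT].
    rewrite ffunE; case: (ltnP j #|T|) => h; last by rewrite nth_default -?cardE.
    by rewrite -mem_enum mem_nth // -cardE.
  have lt : index y (enum T) < k by rewrite (leq_trans _ Tk) // cardE index_mem mem_enum.
  by exists (Ordinal lt) => //; rewrite ffunE /= nth_index // mem_enum.
pose p : P := (b, t, [ffun h : {set 'I_k} * option 'I_k => psi (t @: h.1) (omap t h.2)]).
have tauE B z : tau p (B, z) = psi (B :&: T) (if z \in T then Some z else None).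
  rewrite /tau /p /= ffunE /=; congr psi.
    apply/setP => y; apply/imsetP/setIP => [[j]|[yB]].
      by rewrite inE => jB ->; split=> //; rewrite -ImT imset_f.
    by rewrite -ImT => /imsetP[j _ yj]; exists j => //; rewrite inE -yj.
  case: pickP => [j /eqP tj|no] /=; first by rewrite -tj -ImT imset_f.
  by case: ifP => //; rewrite -{1}ImT => /imsetP[j _ zj]; have := no j; rewrite zj eqxx.
apply: leq_trans (hphi p) _; apply/subset_leq_card/subsetP => x.
rewrite !inE /= ImT => /andP[/andP[-> xT]] /forall_inP hU; rewrite xT /=.
have main B z : (z |: B) :\: T = [set x] ->
    phi (B, z) = psi (B :&: T) (if z \in T then Some z else None).
  by move=> E; rewrite -tauE; apply/eqP/hU; rewrite inE /= ImT E.
have diffE (A B : {set 'I_n}) : A \subset T -> B :\: T = [set x] -> (A :|: B) :\: T = [set x].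
  by move=> AT BT; rewrite setDUl BT (eqP (_ : A :\: T == set0)) ?set0U // setD_eq0.
have xx : [set x] :\: T = [set x].
  by apply/setDidPl; rewrite disjoints1.
apply/forall_inP => A AT; rewrite main; last by rewrite setUC diffE.
rewrite (setIidPl AT) (negbTE xT) eqxx /=; apply/forall_inP => y yT; rewrite main.
  rewrite yT setIUl (setIidPl AT) (_ : [set x] :&: T = set0) ?set0U //.
  by apply/eqP; rewrite setI_eq0 disjoints1.
by rewrite diffE ?sub1set // setUC diffE.
Qed.

(** * From extension steps to minimum degree *)

(** Double counting of the pairs (T, x) with x a choice at T: the set x |: T
    arises from at most k of them. *)
Lemma card_extensions (W : finType) (G : pred {set W}) (S : {set W}) (l k L : nat) :
  #|S| = l -> G S ->
  (forall T : {set W}, S \subset T -> #|T| < k -> G T ->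
     L <= #|[set x | (x \notin T) && G (x |: T)]|) ->
  forall d, l + d <= k ->
  L ^ d <= k ^ d * #|[set T : {set W} | [&& S \subset T, #|T| == l + d & G T]]|.
Proof.
move=> cardS GS step.
pose M d := [set T : {set W} | [&& S \subset T, #|T| == l + d & G T]].
elim=> [|d IH] le_k.
  rewrite mul1n; apply/card_gt0P; exists S.
  by rewrite inE subxx cardS addn0 eqxx GS.
have {}IH := IH ltac:(lia).
rewrite -!/(M _) in IH *.
pose D := [set p : {set W} * W | [&& p.1 \in M d, p.2 \notin p.1 & G (p.2 |: p.1)]].
pose D' := [set p : {set W} * W | (p.1 \in M d.+1) && (p.2 \in p.1)].
have leD : L * #|M d| <= #|D|.
  rewrite mulnC -sum_nat_const.
  have -> : #|D| = \sum_(T in M d) #|[set x | (x \notin T) && G (x |: T)]|.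
    rewrite -sum1_card (eq_bigr (fun T : {set W} => \sum_(x | (x \notin T) && G (x |: T)) 1)).
      rewrite pair_big_dep /=; apply: eq_bigl => -[T x]; by rewrite !inE.
    by move=> T _; rewrite -sum1_card; apply: eq_bigl => x; rewrite inE.
  apply: leq_sum => T; rewrite inE => /and3P[ST /eqP cT GT].
  by apply: step => //; rewrite cT; lia.
have leDD' : #|D| <= #|D'|.
  pose f (p : {set W} * W) := (p.2 |: p.1, p.2).
  have injf : {in D &, injective f}.
    move=> [T x] [T' x']; rewrite !inE /f /= => /and3P[_ xT _] /and3P[_ xT' _] [E xx'].
    by move: E xT'; rewrite -xx' => E xT'; rewrite -(setU1K xT) E setU1K.
  rewrite -(card_in_imset injf); apply/subset_leq_card/subsetP => _ /imsetP[[T x] + ->].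
  rewrite !inE /f /= => /and3P[/and3P[ST /eqP cT _] xT GxT].
  by rewrite subsetU ?ST ?orbT //= cardsU1 xT cT GxT addnS eqxx eqxx.
have cardD' : #|D'| <= k * #|M d.+1|.
  rewrite mulnC -sum_nat_const.
  have -> : #|D'| = \sum_(T in M d.+1) #|T|.
    rewrite -sum1_card (eq_bigr (fun T : {set W} => \sum_(x in T) 1)).
      rewrite pair_big_dep /=; apply: eq_bigl => -[T x]; by rewrite !inE.
    by move=> T _; rewrite -sum1_card.
  by apply: leq_sum => T; rewrite inE => /and3P[_ /eqP-> _].
rewrite !expnS; apply: (@leq_trans (L * (k ^ d * #|M d|))); first by rewrite leq_mul2l IH orbT.
rewrite mulnCA (mulnC k) -mulnA leq_mul2l; apply/orP; right.
by rewrite (leq_trans leD) // (leq_trans leDD').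
Qed.

Lemma degree_card (W : finType) (H : hypergraph W) (S : {set W}) :
  degree H S = #|[set e in H | S \subset e]|.
Proof.
rewrite /degree /link card_in_imset; first by apply: eq_card => e; rewrite !inE.
move=> e e'; rewrite !inE => /andP[_ Se] /andP[_ Se'] E; apply/setP => x.
case: (boolP (x \in S)) => xS; first by rewrite (subsetP Se) // (subsetP Se').
by have /setP/(_ (exist _ x xS)) := E; rewrite !inE.
Qed.

Lemma bin_leq_exp n m : 'C(n, m) <= n ^ m.
Proof.
apply: (@leq_trans (n ^_ m)); first by rewrite -bin_ffact leq_pmulr ?fact_gt0.
elim: m n => [|m IH] [|n] //; rewrite ffactnS expnS /= leq_mul2l /=.
by apply: (leq_trans (IH n)); case: (m) => // m'; rewrite leq_exp2r.
Qed.

Lemma exists_subset_card (T : finType) (A : {set T}) m :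
  m <= #|A| -> exists2 B : {set T}, B \subset A & #|B| = m.
Proof.
rewrite -bin_gt0 -cards_draws => /card_gt0P[B]; rewrite inE => /andP[BA /eqP].
by exists B.
Qed.

(** * Zero density forces a copy in every extendable construction *)

Section Obstruction.
Variables (R : realType) (k l : nat) (V : finType) (F : hypergraph V).
Variables (C : finType) (c0 : C).
Variables (H : forall N, pointed_colouring (k * N) C -> hypergraph 'I_(k * N))
  (G : forall N, pointed_colouring (k * N) C -> {set 'I_(k * N)} -> {set 'I_(k * N)} -> Prop).
Hypotheses (l0 : 0 < l) (lk : l < k) (kH : forall N phi, is_kgraph k (@H N phi))
  (G0 : forall N phi (S : {set 'I_(k * N)}), #|S| = l -> @G N phi S S)
  (Gstep : forall N phi (S T : {set 'I_(k * N)}), #|S| = l -> S \subset T -> #|T| < k -> @G N phi S T ->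
    exists (b : 'I_k) psi, forall x : 'I_(k * N), block x = b -> x \notin T ->
      realizes phi T psi x -> @G N phi S (x |: T))
  (Gend : forall N phi (S e : {set 'I_(k * N)}), #|S| = l -> S \subset e -> #|e| = k ->
    @G N phi S e -> e \in H phi).

(** G phi S T says that T is an admissible intermediate stage on the way from
    the l-set S to an edge of H phi. In a rich colouring every stage of fewer
    than k vertices has at least L continuations, so deg S is at least
    (L / k)^(k - l); since k * N is linear in L, this is a positive proportion
    of 'C(k * N - l, k - l). *)
Lemma zero_density_contains_copy :
  degree_turan_density k l F (0%R : R) -> exists N phi, contains_copy F (@H N phi).
Proof.
move=> pi0; have k0 : 0 < k by lia.
have [K K0 rich] := rich_colouring c0 k0.
pose A := (k * (K + k)) * k.
have A0 : 0 < A by rewrite /A !muln_gt0 addn_gt0 K0 k0.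
have eps0 : (0 < (A ^ (k - l))%:R^-1 :> R)%R by rewrite invr_gt0 ltr0n expn_gt0 A0.
have [n0 _ hn0] : (\forall n \near \oo,
    (ex_degree k l n F)%:R / 'C(n - l, k - l)%:R < (A ^ (k - l))%:R^-1 :> R)%R%classic.
  exact: (@cvgr_lt R nat \oo%classic _ _ _ pi0 _ eps0).

have [L leL [phi hphi]] := rich n0.+1.
set N := K * L + k in phi hphi.
exists N, phi; apply: contraT => noF.
have L0 : 0 < L by lia.
have leN : L <= N by rewrite /N; nia.
have len : N <= k * N by rewrite leq_pmull.
have deg (S : {set 'I_(k * N)}) : #|S| = l -> L ^ (k - l) <= k ^ (k - l) * degree (H phi) S.
  move=> cS; rewrite degree_card.
  have := @card_extensions _ (fun T => `[< G phi S T >]) S l k L cS _ _ (k - l) _.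
  rewrite subnKC ?(ltnW lk) // => h; apply: leq_trans (h _ _ _) _ => //.
  - by apply/asboolP/G0.
  - move=> T ST Tk /asboolP GT; have [b [psi hb]] := Gstep cS ST Tk GT.
    apply: leq_trans (hphi T b psi _) _.
      by rewrite (ltnW Tk) andbT (leq_trans _ (subset_leq_card ST)) // cS.
    apply/subset_leq_card/subsetP => x; rewrite !inE => /andP[/andP[/eqP xb xT] ex].
    by rewrite xT; apply/asboolP/hb.
  - rewrite leq_mul2l; apply/orP; right.
    apply/subset_leq_card/subsetP => T; rewrite !inE => /and3P[ST /eqP cT /asboolP GT].
    by rewrite ST andbT; apply: Gend GT.
have mindeg : L ^ (k - l) <= k ^ (k - l) * min_degree l (H phi).
  rewrite /min_degree; apply: (big_ind (fun y => L ^ (k - l) <= k ^ (k - l) * y)).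
  - have [S SN cS] : exists2 S : {set 'I_(k * N)}, S \subset setT & #|S| = l.
      by apply: exists_subset_card; rewrite cardsT card_ord (leq_trans (ltnW lk)) // leq_pmulr //; lia.
    by apply: leq_trans (deg S cS) _; rewrite leq_mul2l degree_le_edges orbT.
  - by move=> x y hx hy; rewrite /minn; case: ifP.
  - by move=> S /eqP/deg.
have exdeg : min_degree l (H phi) <= ex_degree k l (k * N) F.
  by apply: leq_bigmax_cond; rewrite kH noF.
have := hn0 (k * N) ltac:(rewrite /=; lia).
have bin0 : 0 < 'C(k * N - l, k - l) by rewrite bin_gt0; rewrite leq_sub2r // leq_pmulr //; lia.
rewrite ltr_pdivrMr ?ltr0n // mulrC ltr_pdivlMr ?ltr0n ?expn_gt0 ?A0 // -natrM ltr_nat ltnNge.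
case/negP; apply: leq_trans (bin_leq_exp _ _) _.
apply: (@leq_trans ((k * (K + k) * L) ^ (k - l))).
  rewrite leq_exp2r ?subn_gt0 //; apply: leq_trans (leq_subr _ _) _.
  by rewrite -mulnA leq_mul2l /N; nia.
rewrite expnMn /A [X in _ <= _ * X]expnMn mulnCA leq_mul2l; apply/orP; right.
apply: leq_trans mindeg _; rewrite mulnC leq_mul2r exdeg orbT //.
Qed.

End Obstruction.

(** * Links of (l-1)-sets are partite *)

Section PartiteLinks.
Variables (k l n : nat) (C : finType).
Implicit Types (phi : pointed_colouring n C) (e T A : {set 'I_n}).

Definition rainbow_links phi e := forall A, A \subset e -> #|A| = l - 1 ->
  {in e :\: A &, injective (fun y => phi (A, y))}.

Definition rainbow_hypergraph phi : hypergraph 'I_n :=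
  [set e : {set 'I_n} | (#|e| == k) && `[< rainbow_links phi e >]].

Lemma rainbow_links0 phi (S : {set 'I_n}) : #|S| = l -> 0 < l -> rainbow_links phi S.
Proof.
move=> cS l0 A AS cA y z yA zA _; apply/set1P; move: yA.
suff -> : S :\: A = [set z] by [].
apply/eqP; rewrite eq_sym eqEcard sub1set zA cards1 cardsD (setIidPr AS) cS cA; lia.
Qed.

End PartiteLinks.

Section RainbowExtension.
Variables (k l n r : nat).
Hypotheses (l0 : 0 < l) (kr : k = l + r).

(** For A inside T, the pair (A, x) has to avoid at most k - l colours, so one
    of the k - l + 1 colours is free. For A containing x, the pairs (A, y) all
    involve x, and their colours can be taken to number the at most k - l + 1
    vertices y of T outside A. *)
Lemma rainbow_links_extend (phi : pointed_colouring n 'I_r.+1) (T : {set 'I_n}) :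
  l <= #|T| < k -> rainbow_links l phi T ->
  exists psi, forall x, x \notin T -> realizes phi T psi x ->
    rainbow_links l phi (x |: T).
Proof.
move=> /andP[lT Tk] rT.
exists (fun A o => if o is Some y then inord (index y (enum (T :\: A)))
  else odflt ord0 [pick c | c \notin (fun y => phi (A, y)) @: (T :\: A)]).
move=> x xT /forall_inP real.
have new (A : {set 'I_n}) : A \subset T -> #|A| = l - 1 -> forall y, y \in T :\: A -> phi (A, x) != phi (A, y).
  move=> AT cA y yTA; have /andP[/eqP-> _] := real A AT.
  case: pickP => [c /= cN|all_in]; first by apply: contraNneq cN => ->; exact: (imset_f (fun y => phi (A, y))).
  have : #|[set: 'I_r.+1]| <= #|(fun y => phi (A, y)) @: (T :\: A)|.
    apply/subset_leq_card/subsetP => c _; have /negbFE := all_in c; exact.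
  move=> /leq_trans/(_ (leq_imset_card _ _)).
  rewrite cardsT card_ord cardsD (setIidPr AT) cA ltnNge; case/negP.
  rewrite leq_subLR; apply: leq_trans (_ : k.-1 <= _); last by clear -l0 kr; lia.
  by rewrite -ltnS prednK // (leq_ltn_trans _ Tk).
move=> A AxT cA; case: (boolP (x \in A)) => xA.
  have AxTx : A :\ x \subset T by rewrite subDset.
  have AE : A = x |: (A :\ x) by rewrite setD1K.
  have col y : y \in (x |: T) :\: A -> y \in T :\: (A :\ x) /\
      phi (A, y) = inord (index y (enum (T :\: (A :\ x)))).
    rewrite !inE => /andP[yA /orP[/eqP yx|yT]]; first by rewrite yx xA in yA.
    split; first by rewrite yT (negbTE yA) andbF.
    by have /andP[_ /forall_inP/(_ y yT)] := real _ AxTx; rewrite -AE => /eqP.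
  have lt y : y \in T :\: (A :\ x) -> index y (enum (T :\: (A :\ x))) < r.+1.
    move=> yT; apply: (@leq_trans #|T :\: (A :\ x)|).
      by rewrite cardE index_mem mem_enum.
    rewrite cardsD (setIidPr AxTx); have := cardsD1 x A; rewrite xA cA; lia.
  move=> y z /col[yT ->] /col[zT ->] /(congr1 val) /=.
  rewrite !inordK ?lt // => E.
  rewrite -(@nth_index _ x y (enum (T :\: (A :\ x)))) ?mem_enum //.
  by rewrite E nth_index ?mem_enum.
have AT : A \subset T.
  apply/subsetP => y yA; have := subsetP AxT y yA; rewrite inE => /orP[/set1P yx|//].
  by rewrite -yx yA in xA.
have DE y : y \in (x |: T) :\: A -> y = x \/ y \in T :\: A.
  by rewrite !inE => /andP[-> /orP[/eqP->|->]]; [left|right].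
move=> y z /DE[->|yT] /DE[->|zT] // E.
- by move/eqP: E; rewrite (negbTE (new A AT cA z zT)).
- by move/eqP: E; rewrite eq_sym (negbTE (new A AT cA y yT)).
- exact: rT E.
Qed.
End RainbowExtension.

(** The parts are the colour classes of phi (f(S), .), pulled back along the
    copy f of F. *)
Lemma partite_of_rainbow n k l r (V : finType) (F : hypergraph V)
   (phi : pointed_colouring n 'I_r) (S : {set V}) :
  k = l + r -> is_kgraph k F -> #|S| = l -> contains_copy F (rainbow_hypergraph k l.+1 phi) ->
  is_kgraph r (link F S) /\ is_partite r (link F S).
Proof.
move=> kr /forall_inP kF cS /existsP[f /andP[/injectiveP injf /forall_inP fF]].
have cardlink (e : {set V}) : e \in F -> S \subset e ->
    #|val @^-1: e : {set {x | x \notin S}}| = r.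
  move=> eF Se; rewrite -(card_imset _ val_inj).
  have -> : val @: (val @^-1: e : {set {x | x \notin S}}) = e :\: S.
    apply/setP => x; apply/imsetP/setDP => [[y]|[xe xS]].
      by rewrite inE => ye ->; split=> //; exact: (valP y).
    by exists (Sub x xS); rewrite ?inE ?SubK.
  by rewrite cardsD (setIidPr Se) cS (eqP (kF e eF)) kr; lia.
split.
  apply/forall_inP => e0 /imsetP[e + ->{e0}]; rewrite inE => /andP[eF Se].
  by rewrite cardlink.
pose c (x : {x | x \notin S}) := phi (f @: S, f (val x)).
exists (fun i => [set x | c x == i]); split.
- move=> i j; apply: contraR => /pred0Pn[x /andP[]]; rewrite !inE => /eqP-> /eqP->; exact: eqxx.
- by apply/setP => x; rewrite inE; apply/bigcupP; exists (c x); rewrite ?inE.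
move=> e0 /imsetP[e + ->{e0}] i; rewrite inE => /andP[eF Se].
have := fF e eF; rewrite inE => /andP[_ /asboolP rb].
have injc : {in (val @^-1: e : {set {x | x \notin S}}) &, injective c}.
  move=> x y; rewrite !inE => xe ye E; apply/val_inj/injf.
  have inD (z : {x | x \notin S}) : val z \in e -> f (val z) \in f @: e :\: f @: S.
    by move=> ze; rewrite inE !mem_imset // ze andbT; exact: (valP z).
  apply: (rb (f @: S)) => //; rewrite ?inD ?imsetS //.
  by rewrite card_imset // cS subn1.
have onto : c @: (val @^-1: e) = [set: 'I_r].
  by apply/eqP; rewrite eqEcard subsetT cardsT card_ord card_in_imset // cardlink /=.
have /imsetP[x xe ix] : i \in c @: (val @^-1: e) by rewrite onto inE.
apply/eqP/cards1P; exists x; apply/setP => y; rewrite !inE.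
apply/andP/eqP => [[ye /eqP cy]|->]; last by split; [move: xe; rewrite inE|rewrite ix].
by apply: injc; rewrite ?inE //; [move: xe; rewrite inE|rewrite cy].
Qed.

Lemma zero_density_partite_links (R : realType) (k l : nat) (V : finType) (F : hypergraph V) :
  1 <= l -> l < k -> is_kgraph k F ->
  degree_turan_density k l F (0%R : R) ->
  forall S : {set V}, #|S| = l - 1 ->
     is_kgraph (k - l + 1) (link F S) /\ is_partite (k - l + 1) (link F S).
Proof.
move=> l0 lk kF pi0 S cS; rewrite addn1.
have k0 : 0 < k by lia.
have [|||||N [phi copy]] := @zero_density_contains_copy R k l V F 'I_(k - l).+1 ord0
  (fun N phi => rainbow_hypergraph k l phi) (fun N phi _ T => rainbow_links l phi T) l0 lk.
- by move=> N phi; apply/forall_inP => e; rewrite inE => /andP[].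
- by move=> N phi S' cS'; apply: rainbow_links0.
- move=> N phi S' T cS' S'T Tk rT.
  have [||psi hpsi] := @rainbow_links_extend k l _ (k - l) l0 _ phi T _ rT.
  - by rewrite subnKC // ltnW.
  - by rewrite Tk andbT -cS' subset_leq_card.
  by exists (Ordinal k0), psi => x _; apply: hpsi.
- by move=> N phi S' e _ _ ce re; rewrite inE ce eqxx; apply/asboolP.
- exact: pi0.
apply: (@partite_of_rainbow (k * N) k (l - 1) _ V F phi) => //; first by lia.
by rewrite subn1 prednK.
Qed.

(** * Vanishing orders *)

Definition position_hypergraph k j n (phi : pointed_colouring n {set 'I_k}) : hypergraph 'I_n :=
  [set e : {set 'I_n} | (#|e| == k) && `[< forall v : 'I_k -> 'I_n,
     [set v i | i : 'I_k] = e -> (forall i1 i2 : 'I_k, i1 < i2 -> v i1 < v i2) ->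
     forall (L : {set 'I_k}) i, #|L| = j -> i \in L ->
       phi ([set v a | a in L :\ i], v i) = L >]].

Lemma increasing_endo k (f : 'I_k -> nat) :
  (forall i, f i < k) -> (forall i j : 'I_k, i < j -> f i < f j) -> forall i : 'I_k, f i = i.
Proof.
move=> fk mono.
have ge (g : 'I_k -> nat) : (forall i j : 'I_k, i < j -> g i < g j) -> forall i : 'I_k, i <= g i.
  move=> gm [i lt]; elim: i lt => [//|i IH] lt /=.
  exact: leq_ltn_trans (IH (ltnW lt)) (gm (Ordinal (ltnW lt)) (Ordinal lt) (ltnSn i)).
move=> i; apply/eqP; rewrite eqn_leq ge // andbT.
have rev_mono (a b : 'I_k) : a < b -> k.-1 - f (rev_ord a) < k.-1 - f (rev_ord b).
  move=> ab; have lt : rev_ord b < rev_ord a by have := ltn_ord b; rewrite /=; lia.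
  by have := mono _ _ lt; have := fk (rev_ord a); lia.
have := ge _ rev_mono (rev_ord i); rewrite rev_ordK /=.
by have := ltn_ord i; have := fk i; lia.
Qed.

(** In this section S is the starting l-set and Q a set of k - l blocks that
    avoid S, from each of which one new vertex is to be taken. *)
Section Positions.
Variables (k l N : nat) (S : {set 'I_(k * N)}) (Q : {set 'I_k}).
Hypotheses (cS : #|S| = l) (lk : l <= k) (cQ : #|Q| = k - l)
  (QS : forall s, s \in S -> block s \notin Q).
Implicit Types (x y z : 'I_(k * N)) (T A : {set 'I_(k * N)}).

(** The position of x in the final edge, for x in S or in a block of Q: every
    block of Q before the block of x contributes one smaller vertex. *)
Definition pos x : nat := #|[set s in S | s < x]| + #|[set b in Q | b < block x]|.

(** The common value of pos on a block b of Q. *)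
Definition blockpos (b : 'I_k) : nat :=
  #|[set s in S | block s < b]| + #|[set c in Q | c < b]|.

Definition positions A : {set 'I_k} := [set i : 'I_k | [exists x in A, pos x == i]].

Lemma ltn_of_block x y : block x < block y -> x < y.
Proof. by apply: contraLR; rewrite -!leqNgt => h; apply: leq_div2r. Qed.

Lemma posE x : block x \in Q -> pos x = blockpos (block x).
Proof.
move=> xQ; congr (_ + _); apply: eq_card => s; rewrite !inE; case: (boolP (s \in S)) => //= sS.
apply/idP/idP => [sx|]; last exact: ltn_of_block.
rewrite ltn_neqAle leq_div2r ?(ltnW sx) // andbT.
by apply: contraNneq (QS sS) => E; rewrite (_ : block s = block x) //; apply: val_inj.
Qed.

Lemma positionsU1 x A : positions (x |: A) = [set i : 'I_k | pos x == i] :|: positions A.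
Proof.
apply/setP => i; rewrite !inE; apply/exists_inP/orP => [[y]|[xi|/exists_inP[y yA yi]]].
- by rewrite !inE => /orP[/eqP->|yA yi]; [left|right; apply/exists_inP; exists y].
- by exists x; rewrite ?setU11.
- by exists y; rewrite ?setU1r.
Qed.

Definition transversal T :=
  {in T :\: S, forall x, block x \in Q} /\ {in T :\: S &, injective (@block k N)}.

(** The strictness comes from x itself: it is not counted among the smaller
    elements of S, respectively its block is not counted among the smaller
    blocks. *)
Lemma pos_lt T x : transversal T -> x \in T -> pos x < k.
Proof.
move=> [TQ _] xT; have SQ : #|S| + #|Q| <= k by rewrite cS cQ subnKC.
apply: leq_trans SQ; case: (boolP (x \in S)) => xS.
  rewrite /pos -addSn leq_add //; last first.
    by apply/subset_leq_card/subsetP => b; rewrite inE => /andP[].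
  apply/proper_card/properP; split; first by apply/subsetP => s; rewrite inE => /andP[].
  by exists x => //; rewrite inE ltnn andbF.
have bQ : block x \in Q by apply: TQ; rewrite inE xS.
rewrite /pos -addnS leq_add //.
  by apply/subset_leq_card/subsetP => b; rewrite inE => /andP[].
apply/proper_card/properP; split; first by apply/subsetP => s; rewrite inE => /andP[].
by exists (block x) => //; rewrite inE ltnn andbF.
Qed.

Lemma pos_mono T x y : transversal T -> x \in T -> y \in T -> x < y -> pos x < pos y.
Proof.
move=> [TQ inj] xT yT xy.
have bxy : block x <= block y by rewrite leq_div2r // ltnW.
have leS : #|[set s in S | s < x]| <= #|[set s in S | s < y]|.
  apply/subset_leq_card/subsetP => s; rewrite !inE => /andP[-> /= sx]; exact: ltn_trans xy.
have leQ : #|[set b in Q | b < block x]| <= #|[set b in Q | b < block y]|.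
  apply/subset_leq_card/subsetP => s; rewrite !inE => /andP[-> /= sx]; exact: leq_trans bxy.
case: (boolP (x \in S)) => xS.
  rewrite /pos -addSn leq_add //; apply/proper_card/properP; split.
    by apply/subsetP => s; rewrite !inE => /andP[-> /= sx]; exact: ltn_trans xy.
  by exists x; rewrite !inE xS ?ltnn.
have bQ : block x \in Q by apply: TQ; rewrite inE xS.
have blt : block x < block y.
  rewrite ltn_neqAle bxy andbT; apply/eqP => vE; have E : block x = block y by apply: val_inj.
  have yS : y \notin S by apply: contraL bQ => yS; rewrite E QS.
  by move: xy; rewrite (inj x y) ?ltnn // inE ?xS ?yS.
rewrite /pos -addnS leq_add //; apply/proper_card/properP; split.
  by apply/subsetP => s; rewrite !inE => /andP[-> /= sx]; exact: leq_trans bxy.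
by exists (block x); rewrite !inE bQ ?ltnn.
Qed.

(** By pos_lt and pos_mono, i |-> pos (v i) is an increasing self-map of the k
    positions, hence the identity. *)
Lemma positions_enum e (v : 'I_k -> 'I_(k * N)) (L : {set 'I_k}) :
  transversal e -> [set v i | i : 'I_k] = e ->
  (forall i1 i2 : 'I_k, i1 < i2 -> v i1 < v i2) ->
  positions [set v i | i in L] = L.
Proof.
move=> tr ve mono.
have ine i : v i \in e by rewrite -ve imset_f.
have posv i : pos (v i) = i.
  apply: (@increasing_endo k (fun i => pos (v i))) => [a|a b ab]; first exact: pos_lt tr _.
  by apply: (pos_mono tr) => //; apply: mono.
apply/setP => i; rewrite inE; apply/exists_inP/idP => [[_ /imsetP[a aL ->]]|iL].
  by rewrite posv => /eqP/val_inj <-.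
by exists (v i); rewrite ?imset_f ?posv.
Qed.

Definition well_coloured (phi : pointed_colouring (k * N) {set 'I_k}) T :=
  forall A z, A \subset T -> #|A| = l.+1 -> z \in A -> phi (A :\ z, z) = positions A.

(** Since T has fewer than k vertices, some block b of Q is still unused. Every
    x in b has the same position, so the set of positions of x |: A can be
    prescribed before x is chosen. *)
Lemma position_extend phi T : S \subset T -> #|T| < k ->
  transversal T -> well_coloured phi T ->
  exists b psi, forall x, block x = b -> x \notin T -> realizes phi T psi x ->
    transversal (x |: T) /\ well_coloured phi (x |: T).
Proof.
move=> ST Tk tr col.
have [b bQ bT] : exists2 b, b \in Q & b \notin @block k N @: (T :\: S).
  apply/subsetPn; apply: contraTN isT => /subset_leq_card.
  move=> /leq_trans/(_ (leq_imset_card _ _)).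
  rewrite cQ cardsD (setIidPr ST) cS leqNgt ltn_sub2r //.
  by apply: leq_ltn_trans Tk; rewrite -cS subset_leq_card.
exists b, (fun A o => [set i : 'I_k | blockpos b == i] :|:
   positions (if o is Some y then y |: A else A)).
move=> x xb xT /forall_inP real.
have xpos : pos x = blockpos b by rewrite -xb posE // xb.
have xS : x \notin S by apply: contra xT; exact: (subsetP ST).
split.
  have DE y : y \in (x |: T) :\: S -> y = x \/ y \in T :\: S.
    by rewrite !inE => /andP[-> /orP[/eqP->|->]]; [left|right].
  have [TQ inj] := tr; split=> [y /DE[->|/TQ //]|y z /DE[->|yT] /DE[->|zT] //]; first by rewrite xb.
  - by rewrite xb => E; case/negP: bT; rewrite E imset_f.
  - by rewrite xb => E; case/negP: bT; rewrite -E imset_f.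
  - exact: inj.
move=> A z AxT cA zA; case: (boolP (x \in A)) => xA; last first.
  apply: col => //; apply/subsetP => y yA.
  by have := subsetP AxT y yA; rewrite inE => /orP[/set1P yx|//]; rewrite -yx yA in xA.
have AxTx : A :\ x \subset T by rewrite subDset.
have [zx|zx] := eqVneq z x.
  have /andP[/eqP E _] := real _ AxTx.
  by rewrite zx E -[in RHS](setD1K xA) positionsU1 xpos.
have zT : z \in T by apply: (subsetP AxTx); rewrite !inE zx.
have AzT : A :\ x :\ z \subset T by apply: subset_trans AxTx; apply: subsetDl.
have /andP[_ /forall_inP/(_ z zT)/eqP] := real _ AzT.
have -> : x |: (A :\ x :\ z) = A :\ z.
  rewrite (_ : A :\ x :\ z = A :\ z :\ x); last by rewrite !setDDl setUC.
  by rewrite setD1K // !inE eq_sym zx.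
move=> ->; rewrite setD1K ?inE ?zx // -[in RHS](setD1K xA) positionsU1 xpos //.
Qed.

End Positions.

(** The order of V is that of the images under the copy f. A j-set A of vertices
    gets the colour of (f(A \ z), f(z)) for an arbitrary z in A: inside an edge
    this does not depend on z. *)
Lemma vanishing_of_position_hypergraph k j n (V : finType) (F : hypergraph V)
    (phi : pointed_colouring n {set 'I_k}) :
  0 < j <= k -> contains_copy F (position_hypergraph j phi) ->
  has_vanishing_order j k F.
Proof.
move=> /andP[j0 jk] /existsP[f /andP[/injectiveP injf /forall_inP fF]].
have rank_lt v : #|[set u | f u < f v]| < #|V|.
  rewrite -[leqRHS]cardsT; apply/proper_card/properP; split; first exact: subsetT.
  by exists v; rewrite ?inE ?ltnn.
pose sigma v : 'I_#|V| := Ordinal (rank_lt v).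
have sigma_le u v : f u <= f v -> sigma u <= sigma v.
  by move=> h; apply/subset_leq_card/subsetP => w; rewrite !inE => /leq_trans; apply.
have sigma_lt u v : f u < f v -> sigma u < sigma v.
  move=> h; apply/proper_card/properP; split.
    by apply/subsetP => w; rewrite !inE => /ltn_trans; apply.
  by exists u; rewrite ?inE ?ltnn.
exists sigma; split.
  apply: inj_card_bij; last by rewrite card_ord.
  move=> u v E; apply/injf/val_inj/eqP.
  by case: ltngtP => // /sigma_lt; rewrite E ltnn.
(* Sets whose colour does not have j elements get the default L0. *)
have [L0 _ cL0] : exists2 L0 : {set 'I_k}, L0 \subset [set: 'I_k] & #|L0| = j.
  by apply: exists_subset_card; rewrite cardsT card_ord.
pose colour (A : {set V}) := if [pick z in A] is Some z then phi (f @: (A :\ z), f z) else L0.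
exists (fun A => if #|colour A| == j then colour A else L0); split.
  by move=> A _; case: eqP.
move=> e eF v ve mono L cL.
suff -> : colour [set v i | i in L] = L by rewrite cL eqxx.
rewrite /colour; case: pickP => [z /imsetP[i iL ->]|none]; last first.
  have /card_gt0P[i iL] : 0 < #|L| by rewrite cL.
  by have := none (v i); rewrite imset_f.
have := fF e eF; rewrite inE => /andP[_ /asboolP/(_ (fun i => f (v i))) h].
rewrite -[RHS](h _ _ L i cL iL).
- congr (phi (_, _)).
  have injv : injective v.
    move=> a b E; apply/val_inj/eqP; case: ltngtP => // /mono; rewrite E ltnn //.
  apply/setP => y; apply/imsetP/imsetP => [[w]|[a]].
    by rewrite !inE => /andP[wi /imsetP[a aL wa]] ->; exists a; rewrite ?wa // !inE aL andbT;
      apply: contraNneq wi => <-; rewrite wa.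
  rewrite !inE => /andP[ai aL] ->; exists (v a) => //; rewrite !inE imset_f // andbT.
  by rewrite (inj_eq injv).
- rewrite -ve; apply/setP => y; apply/imsetP/imsetP => [[a _ ->]|[w]].
    by exists (v a) => //; apply: imset_f.
  by move=> /imsetP[a _ ->] ->; exists a.
- move=> i1 i2 /mono; apply: contraLR; rewrite -!leqNgt; exact: sigma_le.
Qed.

Lemma zero_density_vanishing_order (R : realType) (k l : nat) (V : finType) (F : hypergraph V) :
  1 <= l -> l < k -> degree_turan_density k l F (0%R : R) ->
  has_vanishing_order l.+1 k F.
Proof.
move=> l0 lk pi0.
have [|||||N [phi copy]] := @zero_density_contains_copy R k l V F {set 'I_k} set0
  (fun N phi => position_hypergraph l.+1 phi)
  (fun N phi S T => exists Q : {set 'I_k},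
     [/\ #|Q| = k - l, forall s, s \in S -> block s \notin Q,
         transversal S Q T & well_coloured l S Q phi T]) l0 lk.
- by move=> N phi; apply/forall_inP => e; rewrite inE => /andP[].
- move=> N phi S cS.
  have [Q QS cQ] : exists2 Q : {set 'I_k}, Q \subset ~: (@block k N @: S) & #|Q| = k - l.
    apply: exists_subset_card; rewrite cardsCs setCK card_ord leq_sub2l //.
    by rewrite -cS leq_imset_card.
  exists Q; split=> //.
  + by move=> s sS; apply: contraL (imset_f (@block k N) sS) => /(subsetP QS); rewrite inE.
  + by split=> [x|x y]; rewrite setDv inE.
  + by move=> A z /subset_leq_card; rewrite cS => h E; rewrite E ltnn in h.
- move=> N phi S T cS ST Tk [Q [cQ QS tr col]].
  have [b [psi h]] := position_extend cS cQ QS ST Tk tr col.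
  exists b, psi => x xb xT rx; exists Q; have [] := h x xb xT rx; split=> //.
- move=> N phi S e cS Se ce [Q [cQ QS tr col]]; rewrite inE ce eqxx /=; apply/asboolP.
  move=> v ve mono L i cL iL.
  have injv : injective v.
    move=> a b E; apply/val_inj/eqP; case: ltngtP => // /mono; rewrite E ltnn //.
  have -> : [set v a | a in L :\ i] = [set v a | a in L] :\ v i.
    apply/setP => y; apply/imsetP/setD1P => [[a]|[yi /imsetP[a aL ya]]].
      by rewrite !inE => /andP[ai aL] ->; rewrite (inj_eq injv) imset_f.
    by exists a => //; rewrite !inE aL andbT; apply: contraNneq yi => <-; rewrite ya.
  rewrite col ?imset_f ?card_imset //; first exact: (positions_enum cS (ltnW lk) cQ QS L tr ve mono).
  by rewrite -ve; apply/subsetP => _ /imsetP[a _ ->]; rewrite imset_f.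
- exact: pi0.
by apply: (vanishing_of_position_hypergraph _ copy).
Qed.

Theorem theorem1p6 (R : realType) (k l : nat) (V : finType) (F : hypergraph V)
    (l_ge1 : 1 <= l) (l_lt_k : l < k) (F_kgraph : is_kgraph k F)
    (pi_F_eq0 : degree_turan_density k l F (0%R : R)) :
  has_vanishing_order (l + 1) k F /\
  (forall S : {set V}, #|S| = l - 1 ->
     is_kgraph (k - l + 1) (link F S) /\ is_partite (k - l + 1) (link F S)).
Proof.
split; last exact: zero_density_partite_links pi_F_eq0.
by rewrite addn1; exact: zero_density_vanishing_order l_lt_k pi_F_eq0.
Qed.
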